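(* Let $0<q<1$. For complex numbers $a,b,c,d$ with $\mathrm{Re}(a+b+c+d)>0$, and such that every $q^2$-gamma value occurring below is evaluated at a point that is not a non-positive integer, \[ \sum_{n=0}^{\infty}\frac{(1-q^{4n+2a+1})(1/2|q^{2})_{a+n}(1/2|q^{2})_{n-b}(1/3|q^{2})_{n-c}(2/3|q^{2})_{n-d}}{(1-q^{2})[n]_{q^{2}}!\,(1|q^{2})_{a+b+n}(7/6|q^{2})_{a+c+n}(5/6|q^{2})_{a+d+n}}\,q^{2(a+b+c+d)n} \] \[ =\frac{(1/2|q^{2})_{-b}(1/3|q^{2})_{-c}(2/3|q^{2})_{-d}(1|q^{2})_{a+b+c+d-1}}{(1/3|q^{2})_{a+b+d}(2/3|q^{2})_{a+b+c}(1/2|q^{2})_{a+c+d}}\cdot\frac{[1/6]_{q^{2}}\,(q^{4/3},q^{2/3};q^{2})_{\infty}\,q^{1/4}}{(q^{1/3},q^{5/3};q^{2})_{\infty}\,\pi_{q}}. \]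
   Context: Let $0<q<1$ and write $q^{x}=e^{x\log q}$. $(z;q)_\infty=\prod_{k\ge0}(1-zq^k)$, $(z_1,z_2;q)_\infty=(z_1;q)_\infty(z_2;q)_\infty$. $\Gamma_{q^2}(x)=\frac{(q^2;q^2)_\infty}{(q^{2x};q^2)_\infty}(1-q^2)^{1-x}$; for complex $x,\alpha$, $(x|q^2)_\alpha=\Gamma_{q^2}(x+\alpha)/\Gamma_{q^2}(x)$. $[z]_{q^2}=\frac{1-q^{2z}}{1-q^2}$, $[0]_{q^2}!=1$, $[n]_{q^2}!=\prod_{k=1}^n[k]_{q^2}$. $\pi_q=(1-q^2)q^{1/4}\frac{(q^2;q^2)_\infty^2}{(q;q^2)_\infty^2}$.
   Formalization: The condition that gamma arguments are not non-positive integers is read as: no argument x is a pole of the q²-gamma function, i.e. (q^{2x};q²)_∞ ≠ 0, which also excludes the non-real poles x = −k + iπm/log q where the formula is undefined. *)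

(* Defs.v *)
From Stdlib Require Import Reals ClassicalEpsilon.
Open Scope R_scope.

Record CC : Type := mkC { Cre : R ; Cim : R }.

Definition RtoC (x : R) : CC := mkC x 0.
Definition CC0 : CC := RtoC 0.
Definition CC1 : CC := RtoC 1.
Definition Cadd (z w : CC) : CC := mkC (Cre z + Cre w) (Cim z + Cim w).
Definition Copp (z : CC) : CC := mkC (- Cre z) (- Cim z).
Definition Csub (z w : CC) : CC := Cadd z (Copp w).
Definition Cmul (z w : CC) : CC :=
  mkC (Cre z * Cre w - Cim z * Cim w) (Cre z * Cim w + Cim z * Cre w).
Definition Cinv (z : CC) : CC :=
  let d := Cre z * Cre z + Cim z * Cim z in mkC (Cre z / d) (- Cim z / d).
Definition Cdiv (z w : CC) : CC := Cmul z (Cinv w).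
Definition Cnorm (z : CC) : R := sqrt (Cre z * Cre z + Cim z * Cim z).
Definition Cexp (z : CC) : CC := mkC (exp (Cre z) * cos (Cim z)) (exp (Cre z) * sin (Cim z)).
Definition qpow (q : R) (x : CC) : CC := Cexp (Cmul x (RtoC (ln q))).

Definition Cseq_cv (u : nat -> CC) (l : CC) : Prop :=
  forall eps : R, eps > 0 -> exists N : nat, forall n : nat, (n >= N)%nat -> Cnorm (Csub (u n) l) < eps.
Definition Clim (u : nat -> CC) : CC :=
  epsilon (inhabits CC0) (fun l => Cseq_cv u l).

Fixpoint Cprod_upto (f : nat -> CC) (N : nat) : CC :=
  match N with O => CC1 | S k => Cmul (Cprod_upto f k) (f k) end.
Fixpoint Csum_upto (f : nat -> CC) (N : nat) : CC :=
  match N with O => CC0 | S k => Cadd (Csum_upto f k) (f k) end.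

Definition qPoch_inf (z : CC) (p : R) : CC :=
  Clim (fun N => Cprod_upto (fun k => Csub CC1 (Cmul z (RtoC (p ^ k)))) N).

Definition qGamma2 (q : R) (x : CC) : CC :=
  Cmul (Cdiv (qPoch_inf (RtoC (q ^ 2)) (q ^ 2))
             (qPoch_inf (qpow q (Cmul (RtoC 2) x)) (q ^ 2)))
       (Cexp (Cmul (Csub CC1 x) (RtoC (ln (1 - q ^ 2))))).

Definition qGamma2_defined (q : R) (x : CC) : Prop :=
  qPoch_inf (qpow q (Cmul (RtoC 2) x)) (q ^ 2) <> CC0.

Definition qshift (q : R) (x alpha : CC) : CC :=
  Cdiv (qGamma2 q (Cadd x alpha)) (qGamma2 q x).

Definition qnum2 (q : R) (z : CC) : CC :=
  Cdiv (Csub CC1 (qpow q (Cmul (RtoC 2) z))) (RtoC (1 - q ^ 2)).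

Definition qfact2 (q : R) (n : nat) : CC :=
  Cprod_upto (fun k => qnum2 q (RtoC (INR (S k)))) n.

Definition pi_q (q : R) : CC :=
  Cmul (Cmul (RtoC (1 - q ^ 2)) (qpow q (RtoC (1/4))))
       (Cdiv (Cmul (qPoch_inf (RtoC (q ^ 2)) (q ^ 2)) (qPoch_inf (RtoC (q ^ 2)) (q ^ 2)))
             (Cmul (qPoch_inf (RtoC q) (q ^ 2)) (qPoch_inf (RtoC q) (q ^ 2)))).

Definition rc (x : R) : CC := RtoC x.
Definition nc (n : nat) : CC := RtoC (INR n).

(* Main.v *)
(* After removing the q-gamma factors, the series is a nonterminating very-well-poised 6phi5
   series to the base p = q ^ 2 with A = q ^ (2a+1), B = q ^ (1-2b), C = q ^ (2/3-2c),
   D = q ^ (4/3-2d) and argument x = A p / (B C D) = p ^ (a+b+c+d), whose sum is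
     (A, Ap/BC, Ap/BD, Ap/CD; p)_oo / (Ap/B, Ap/C, Ap/D, Ap/BCD; p)_oo
   when the summand is normalised to start with 1 - A. Creative telescoping relates the partial
   sums for A and for A p up to a boundary term that vanishes since |x| < 1. Iterating A -> A p ^ k
   produces the finite products of the right-hand side, and as k grows the shifted series tends
   to its leading term 1, uniformly in the number of summands, because the ratio of consecutive
   terms is O(p ^ k). *)
Require Import Defs.
From Stdlib Require Import Reals Lra Lia ClassicalEpsilon.
From Coquelicot Require Rcomplements Complex.
From Coquelicot Require Import Hierarchy Lim_seq Series Rbar.
Open Scope R_scope.

(* Complex numbers as a field *)
Declare Scope CC_scope.
Delimit Scope CC_scope with CC.
Bind Scope CC_scope with CC.
Notation "z + w" := (Cadd z w) : CC_scope.
Notation "z - w" := (Csub z w) : CC_scope.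
Notation "z * w" := (Cmul z w) : CC_scope.
Notation "z / w" := (Cdiv z w) : CC_scope.
Notation "- z" := (Copp z) : CC_scope.

Lemma CC_ext (z w : CC) : Cre z = Cre w -> Cim z = Cim w -> z = w.
Proof. destruct z, w; simpl; intros -> ->; reflexivity. Qed.

Lemma CC_field_theory :
  field_theory CC0 CC1 Cadd Cmul Csub Copp Cdiv Cinv (@eq CC).
Proof.
  repeat split; intros; try (apply CC_ext; simpl; ring).
  - intros H. apply (f_equal Cre) in H. simpl in H. lra.
  - rename H into Hp. assert (Hd : Cre p * Cre p + Cim p * Cim p <> 0).
    { intros H0. apply Hp. apply CC_ext; simpl; nra. }
    apply CC_ext; simpl; field; exact Hd.
Qed.
Add Field CC_field : CC_field_theory.

Lemma RtoC_plus (x y : R) : RtoC (x + y) = (RtoC x + RtoC y)%CC.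
Proof. apply CC_ext; simpl; ring. Qed.

Lemma RtoC_mult (x y : R) : RtoC (x * y) = (RtoC x * RtoC y)%CC.
Proof. apply CC_ext; simpl; ring. Qed.

Lemma RtoC_neq0 (x : R) : x <> 0 -> RtoC x <> CC0.
Proof. intros Hx H. apply Hx. exact (f_equal Cre H). Qed.

Lemma CC1_neq0 : CC1 <> CC0.
Proof. apply RtoC_neq0; lra. Qed.

Lemma CC_mul_neq0 (z w : CC) : (z * w)%CC <> CC0 -> z <> CC0 /\ w <> CC0.
Proof. intros H; split; intros E; apply H; rewrite E; ring. Qed.

Lemma CC_neq0_mul (z w : CC) : z <> CC0 -> w <> CC0 -> (z * w)%CC <> CC0.
Proof.
  intros Hz Hw H. apply Hw. replace w with (z * w / z)%CC by (field; exact Hz).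
  rewrite H. field. exact Hz.
Qed.

(** * Norm and limits *)

Lemma Cnorm_Cmod (z : CC) : Cnorm z = Complex.Cmod (Cre z, Cim z).
Proof. unfold Cnorm, Complex.Cmod; simpl. f_equal. ring. Qed.

Lemma Cnorm_mul (z w : CC) : Cnorm (z * w) = Cnorm z * Cnorm w.
Proof. rewrite !Cnorm_Cmod. apply (Complex.Cmod_mult (Cre z, Cim z) (Cre w, Cim w)). Qed.

Lemma Cnorm_add (z w : CC) : Cnorm (z + w) <= Cnorm z + Cnorm w.
Proof. rewrite !Cnorm_Cmod. apply (Complex.Cmod_triangle (Cre z, Cim z) (Cre w, Cim w)). Qed.

Lemma Cnorm_opp (z : CC) : Cnorm (- z) = Cnorm z.
Proof. unfold Cnorm; simpl. f_equal. ring. Qed.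

Lemma Cnorm_sub (z w : CC) : Cnorm (z - w) <= Cnorm z + Cnorm w.
Proof. unfold Csub. rewrite <- (Cnorm_opp w). apply Cnorm_add. Qed.

Lemma Cnorm_sub_ge (z w : CC) : Cnorm z - Cnorm w <= Cnorm (z - w).
Proof.
  replace z with (z - w + w)%CC at 1 by ring.
  pose proof (Cnorm_add (z - w) w). lra.
Qed.

Lemma Cnorm_ge0 (z : CC) : 0 <= Cnorm z.
Proof. apply sqrt_pos. Qed.

Lemma Cnorm_RtoC (x : R) : 0 <= x -> Cnorm (RtoC x) = x.
Proof.
  intros Hx. unfold Cnorm; simpl. rewrite <- (sqrt_square x) at 3 by exact Hx.
  f_equal; ring.
Qed.

Lemma Cnorm_CC1 : Cnorm CC1 = 1.
Proof. apply Cnorm_RtoC; lra. Qed.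

Lemma Cnorm_gt0 (z : CC) : z <> CC0 -> 0 < Cnorm z.
Proof.
  intros H. apply sqrt_lt_R0.
  destruct (Req_dec (Cre z) 0) as [Hr|Hr].
  - destruct (Req_dec (Cim z) 0) as [Hi|Hi]; [|nra].
    exfalso. apply H. apply CC_ext; simpl; assumption.
  - nra.
Qed.

Lemma Cnorm_div (z w : CC) : w <> CC0 -> Cnorm (z / w) = Cnorm z / Cnorm w.
Proof.
  intros Hw. pose proof (Cnorm_gt0 w Hw).
  replace z with (z / w * w)%CC at 2 by (field; exact Hw).
  rewrite Cnorm_mul. field. lra.
Qed.

Lemma Cnorm_re_im (z : CC) : Rabs (Cre z) <= Cnorm z /\ Rabs (Cim z) <= Cnorm z.
Proof.
  unfold Cnorm. rewrite <- !sqrt_Rsqr_abs. unfold Rsqr.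
  split; apply sqrt_le_1_alt; nra.
Qed.

Lemma Cnorm_le_re_im (z : CC) : Cnorm z <= Rabs (Cre z) + Rabs (Cim z).
Proof.
  unfold Cnorm. rewrite <- (sqrt_square (Rabs (Cre z) + Rabs (Cim z))).
  2: { pose proof (Rabs_pos (Cre z)); pose proof (Rabs_pos (Cim z)); lra. }
  apply sqrt_le_1_alt.
  pose proof (Rsqr_abs (Cre z)) as H1; pose proof (Rsqr_abs (Cim z)) as H2. unfold Rsqr in *.
  pose proof (Rmult_le_pos _ _ (Rabs_pos (Cre z)) (Rabs_pos (Cim z))). nra.
Qed.

(** The norm lies between each of |Re|, |Im| and their sum |Re| + |Im|. All the limit rules below
    are inherited from real sequences through this equivalence. *)
Lemma Cseq_cv_components (u : nat -> CC) (l : CC) :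
  Cseq_cv u l <->
  is_lim_seq (fun n => Cre (u n)) (Cre l) /\ is_lim_seq (fun n => Cim (u n)) (Cim l).
Proof.
  rewrite !is_lim_seq_Reals. split.
  - intros H; split; intros eps He; destruct (H eps He) as [N HN]; exists N; intros n Hn;
      specialize (HN n Hn); destruct (Cnorm_re_im (u n - l)) as [H1 H2];
      unfold Rdist; simpl in *; unfold Rminus; lra.
  - intros [H1 H2] eps He.
    destruct (H1 (eps / 2) ltac:(lra)) as [N1 HN1].
    destruct (H2 (eps / 2) ltac:(lra)) as [N2 HN2].
    exists (Nat.max N1 N2). intros n Hn.
    specialize (HN1 n ltac:(lia)). specialize (HN2 n ltac:(lia)).
    pose proof (Cnorm_le_re_im (u n - l)). unfold Rdist, Rminus in *. simpl in *. lra.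
Qed.

Lemma Cseq_cv_unique (u : nat -> CC) (l l' : CC) : Cseq_cv u l -> Cseq_cv u l' -> l = l'.
Proof.
  rewrite !Cseq_cv_components. intros [H1 H2] [H3 H4].
  apply is_lim_seq_unique in H1, H2, H3, H4.
  apply CC_ext; congruence.
Qed.

Lemma Cseq_cv_ext (u v : nat -> CC) (l : CC) :
  (forall n, u n = v n) -> Cseq_cv u l -> Cseq_cv v l.
Proof.
  intros E H eps He. destruct (H eps He) as [N HN]. exists N. intros n Hn.
  rewrite <- E. exact (HN n Hn).
Qed.

Lemma Cseq_cv_const (c : CC) : Cseq_cv (fun _ => c) c.
Proof. apply Cseq_cv_components; split; apply is_lim_seq_const. Qed.

Lemma Cseq_cv_add (u v : nat -> CC) (l m : CC) :
  Cseq_cv u l -> Cseq_cv v m -> Cseq_cv (fun n => u n + v n)%CC (l + m)%CC.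
Proof.
  rewrite !Cseq_cv_components. intros [H1 H2] [H3 H4]; simpl.
  split; apply is_lim_seq_plus'; assumption.
Qed.

Lemma Cseq_cv_mul (u v : nat -> CC) (l m : CC) :
  Cseq_cv u l -> Cseq_cv v m -> Cseq_cv (fun n => u n * v n)%CC (l * m)%CC.
Proof.
  rewrite !Cseq_cv_components. intros [H1 H2] [H3 H4]; simpl. split.
  - apply is_lim_seq_minus'; apply is_lim_seq_mult'; assumption.
  - apply is_lim_seq_plus'; apply is_lim_seq_mult'; assumption.
Qed.

Lemma Cseq_cv_div (u v : nat -> CC) (l m : CC) :
  m <> CC0 -> Cseq_cv u l -> Cseq_cv v m -> Cseq_cv (fun n => u n / v n)%CC (l / m)%CC.
Proof.
  intros Hm Hu Hv. apply Cseq_cv_mul; [exact Hu|].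
  apply Cseq_cv_components in Hv. destruct Hv as [H1 H2].
  assert (Hd : Cre m * Cre m + Cim m * Cim m <> 0).
  { intros H0. apply Hm. apply CC_ext; simpl; nra. }
  apply Cseq_cv_components; simpl.
  split; (apply is_lim_seq_div'; [| |exact Hd]).
  all: try (apply is_lim_seq_plus'; apply is_lim_seq_mult'; assumption).
  - assumption.
  - apply (is_lim_seq_opp _ (Cim m)); assumption.
Qed.

Lemma Cseq_cv_sub (u v : nat -> CC) (l m : CC) :
  Cseq_cv u l -> Cseq_cv v m -> Cseq_cv (fun n => u n - v n)%CC (l - m)%CC.
Proof.
  rewrite !Cseq_cv_components. intros [H1 H2] [H3 H4]; simpl.
  split; apply (is_lim_seq_minus' _ _ _ _); assumption.
Qed.

Lemma Cseq_cv_0_norm (u : nat -> CC) : is_lim_seq (fun n => Cnorm (u n)) 0 -> Cseq_cv u CC0.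
Proof.
  intros H eps He. apply is_lim_seq_Reals in H.
  destruct (H eps He) as [N HN]. exists N. intros n Hn. specialize (HN n Hn).
  replace (u n - CC0)%CC with (u n) by ring.
  unfold Rdist in HN. rewrite Rminus_0_r in HN.
  pose proof (Rle_abs (Cnorm (u n))). lra.
Qed.

Lemma RtoC_pow_cv0 (p : R) : 0 < p < 1 -> Cseq_cv (fun n => RtoC (p ^ n)) CC0.
Proof.
  intros Hp. apply Cseq_cv_components; simpl. split; [|apply is_lim_seq_const].
  apply is_lim_seq_geom. rewrite Rabs_pos_eq; lra.
Qed.

(** The increments are dominated by a convergent geometric series, and their partial sums telescope
    to [u]. *)
Lemma real_seq_cv_of_geom_increments (u : nat -> R) (p M : R) :
  0 < p < 1 -> (forall n, Rabs (u (S n) - u n) <= M * p ^ n) -> exists l : R, is_lim_seq u l.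
Proof.
  intros Hp H.
  assert (Hs : ex_series (fun n => u (S n) - u n)).
  { apply (@ex_series_le R_AbsRing R_CompleteNormedModule _ (fun n => M * p ^ n)); [exact H|].
    apply (@ex_series_scal R_AbsRing R_NormedModule M (fun n => p ^ n)). apply ex_series_geom. rewrite Rabs_pos_eq; lra. }
  destruct Hs as [s Hs]. exists (s + u 0%nat).
  (* [sum_n] up to [n] has n + 1 summands and so telescopes to [u (S n) - u 0]; hence the passage to
     the shifted sequence. *)
  apply is_lim_seq_incr_1.
  apply is_lim_seq_ext with (fun n => sum_n (fun k => u (S k) - u k) n + u 0%nat).
  - induction n as [|n IH].
    + rewrite sum_O. simpl. ring.
    + rewrite sum_Sn. unfold plus; simpl. simpl in IH.
      transitivity (u (S (S n)) - u (S n) + (sum_n (fun k => u (S k) - u k) n + u 0%nat)); [ring|].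
      rewrite IH. ring.
  - apply is_lim_seq_plus'; [exact Hs|apply is_lim_seq_const].
Qed.

Lemma Cseq_cv_of_geom_increments (u : nat -> CC) (p M : R) :
  0 < p < 1 -> (forall n, Cnorm (u (S n) - u n) <= M * p ^ n) -> exists l : CC, Cseq_cv u l.
Proof.
  intros Hp H.
  destruct (real_seq_cv_of_geom_increments (fun n => Cre (u n)) p M Hp) as [x Hx].
  { intros n. apply Rle_trans with (2 := H n). apply (Cnorm_re_im (u (S n) - u n)). }
  destruct (real_seq_cv_of_geom_increments (fun n => Cim (u n)) p M Hp) as [y Hy].
  { intros n. apply Rle_trans with (2 := H n). apply (Cnorm_re_im (u (S n) - u n)). }
  exists (mkC x y). apply Cseq_cv_components. simpl. split; assumption.
Qed.

(** * q-Pochhammer symbols *)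

(** The finite symbol (z;p)_n. It is convertible with the partial product inside [qPoch_inf], so it
    can be folded there. *)
Definition poch (p : R) (z : CC) (n : nat) : CC :=
  Cprod_upto (fun k => CC1 - z * RtoC (p ^ k))%CC n.

Lemma poch_S (p : R) (z : CC) (n : nat) :
  poch p z (S n) = (poch p z n * (CC1 - z * RtoC (p ^ n)))%CC.
Proof. reflexivity. Qed.

(** Both sides are (z;p)_{n+1}, with the first or the last factor split off. No division by 1 - z
    occurs, so z = 1 is covered. *)
Lemma poch_shift (p : R) (z : CC) (n : nat) :
  ((CC1 - z) * poch p (z * RtoC p) n = poch p z n * (CC1 - z * RtoC (p ^ n)))%CC.
Proof.
  induction n as [|n IH].
  - unfold poch; simpl. change (RtoC 1) with CC1. ring.
  - rewrite !poch_S, <- IH. simpl pow. rewrite RtoC_mult. ring.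
Qed.

(** Each factor has norm at most 1 + |z| p^k <= exp(|z| p^k), and the exponents form a geometric
    series. *)
Lemma poch_norm_bound (p : R) (z : CC) (n : nat) :
  0 < p < 1 -> Cnorm (poch p z n) <= exp (Cnorm z / (1 - p)).
Proof.
  intros Hp.
  assert (H : Cnorm (poch p z n) <= exp (Cnorm z * ((1 - p ^ n) / (1 - p)))).
  { induction n as [|n IH].
    - unfold poch; simpl. rewrite Cnorm_CC1.
      replace (Cnorm z * ((1 - 1) / (1 - p))) with 0 by (field; lra). rewrite exp_0; lra.
    - rewrite poch_S, Cnorm_mul.
      replace (Cnorm z * ((1 - p ^ S n) / (1 - p)))
        with (Cnorm z * ((1 - p ^ n) / (1 - p)) + Cnorm z * p ^ n) by (simpl; field; lra).
      rewrite exp_plus.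
      apply Rmult_le_compat; try apply Cnorm_ge0; [exact IH|].
      apply Rle_trans with (1 := Cnorm_sub _ _).
      rewrite Cnorm_CC1, Cnorm_mul, Cnorm_RtoC by (apply pow_le; lra).
      apply exp_ineq1_le. }
  apply Rle_trans with (1 := H).
  assert (L : Cnorm z * ((1 - p ^ n) / (1 - p)) <= Cnorm z / (1 - p)).
  { unfold Rdiv. rewrite <- Rmult_assoc.
    apply Rmult_le_compat_r; [left; apply Rinv_0_lt_compat; lra|].
    pose proof (Cnorm_ge0 z). pose proof (pow_lt p n ltac:(lra)). nra. }
  destruct L as [L|E]; [left; apply exp_increasing; exact L|rewrite E; lra].
Qed.

(** [Clim] picks a limit by [epsilon], so existence suffices: consecutive products differ by (z;p)_n
    z p^n, which the uniform bound on (z;p)_n makes geometrically small. *)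
Lemma poch_cv (p : R) (z : CC) : 0 < p < 1 -> Cseq_cv (poch p z) (qPoch_inf z p).
Proof.
  intros Hp. unfold qPoch_inf, Clim. apply epsilon_spec.
  apply Cseq_cv_of_geom_increments with p (exp (Cnorm z / (1 - p)) * Cnorm z); [exact Hp|].
  intros n. fold (poch p z (S n)) (poch p z n). rewrite poch_S.
  replace (poch p z n * (CC1 - z * RtoC (p ^ n)) - poch p z n)%CC
    with (poch p z n * (- (z * RtoC (p ^ n))))%CC by ring.
  rewrite Cnorm_mul, Cnorm_opp, Cnorm_mul, Cnorm_RtoC by (apply pow_le; lra).
  rewrite <- Rmult_assoc.
  apply Rmult_le_compat_r; [apply pow_le; lra|].
  apply Rmult_le_compat_r; [apply Cnorm_ge0|]. apply poch_norm_bound, Hp.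
Qed.

Lemma qPoch_inf_step (p : R) (z : CC) :
  0 < p < 1 -> qPoch_inf z p = ((CC1 - z) * qPoch_inf (z * RtoC p) p)%CC.
Proof.
  intros Hp.
  pose proof (RtoC_pow_cv0 p Hp) as Hpow.
  apply Cseq_cv_unique with (fun n => poch p z n * (CC1 - z * RtoC (p ^ n)))%CC.
  - replace (qPoch_inf z p) with (qPoch_inf z p * (CC1 - z * CC0))%CC by ring.
    apply Cseq_cv_mul; [apply poch_cv, Hp|].
    apply Cseq_cv_sub; [apply Cseq_cv_const|].
    apply Cseq_cv_mul; [apply Cseq_cv_const|exact Hpow].
  - apply Cseq_cv_ext with (fun n => (CC1 - z) * poch p (z * RtoC p) n)%CC.
    { intros n. apply poch_shift. }
    apply Cseq_cv_mul; [apply Cseq_cv_const|apply poch_cv, Hp].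
Qed.

Lemma qPoch_inf_split (p : R) (z : CC) (n : nat) :
  0 < p < 1 -> qPoch_inf z p = (poch p z n * qPoch_inf (z * RtoC (p ^ n)) p)%CC.
Proof.
  intros Hp. induction n as [|n IH].
  - unfold poch; simpl. change (RtoC 1) with CC1.
    replace (z * CC1)%CC with z by ring. ring.
  - rewrite IH, poch_S, (qPoch_inf_step p (z * RtoC (p ^ n))) by exact Hp.
    replace (z * RtoC (p ^ n) * RtoC p)%CC with (z * RtoC (p ^ S n))%CC.
    + ring.
    + simpl pow. rewrite RtoC_mult. ring.
Qed.

Lemma poch_neq0 (p : R) (z : CC) (n : nat) :
  0 < p < 1 -> qPoch_inf z p <> CC0 -> poch p z n <> CC0.
Proof. intros Hp H. rewrite (qPoch_inf_split p z n Hp) in H. apply (CC_mul_neq0 _ _ H). Qed.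

Lemma poch_factor_neq0 (p : R) (z : CC) (n : nat) :
  0 < p < 1 -> qPoch_inf z p <> CC0 -> (CC1 - z * RtoC (p ^ n))%CC <> CC0.
Proof.
  intros Hp H. apply (poch_neq0 p z (S n) Hp) in H. apply (CC_mul_neq0 _ _ H).
Qed.

Lemma qPoch_inf_shift_neq0 (p : R) (z : CC) (n : nat) :
  0 < p < 1 -> qPoch_inf z p <> CC0 -> qPoch_inf (z * RtoC (p ^ n)) p <> CC0.
Proof. intros Hp H. rewrite (qPoch_inf_split p z n Hp) in H. apply (CC_mul_neq0 _ _ H). Qed.

(** * The nonterminating very-well-poised sum *)

(** The well-poised part of the 6phi5 summand; the last product is the n-th power of the argument x
    = A p / (B C D). *)
Definition wp_coef (p : R) (A B C D : CC) (n : nat) : CC :=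
  (poch p A n * poch p B n * poch p C n * poch p D n
   / (poch p (RtoC p) n * poch p (A * RtoC p / B) n
      * poch p (A * RtoC p / C) n * poch p (A * RtoC p / D) n)
   * Cprod_upto (fun _ => A * RtoC p / (B * C * D)) n)%CC.

(** The very-well-poised factor is 1 - A p^(2n), without the usual denominator 1 - A. Writing p^(2n)
    as p^n p^n makes the later identities rational in the single quantity p^n. *)
Definition wp_term (p : R) (A B C D : CC) (n : nat) : CC :=
  ((CC1 - A * RtoC (p ^ n) * RtoC (p ^ n)) * wp_coef p A B C D n)%CC.

Definition wp_ratio (p : R) (A B C D : CC) (n : nat) : CC :=
  ((CC1 - A * RtoC (p ^ n)) * (CC1 - B * RtoC (p ^ n))
   * (CC1 - C * RtoC (p ^ n)) * (CC1 - D * RtoC (p ^ n))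
   / ((CC1 - RtoC p * RtoC (p ^ n)) * (CC1 - A * RtoC p / B * RtoC (p ^ n))
      * (CC1 - A * RtoC p / C * RtoC (p ^ n)) * (CC1 - A * RtoC p / D * RtoC (p ^ n)))
   * (A * RtoC p / (B * C * D)))%CC.

(** An infinite product that does not vanish forces every finite product (z;p)_n and every factor 1
    - z p^n to be nonzero, so these conditions control the denominators for all n and those of the
    closed form. *)
Definition wp_regular (p : R) (A B C D : CC) : Prop :=
  B <> CC0 /\ C <> CC0 /\ D <> CC0 /\
  qPoch_inf (RtoC p) p <> CC0 /\ qPoch_inf (A * RtoC p / B)%CC p <> CC0 /\
  qPoch_inf (A * RtoC p / C)%CC p <> CC0 /\ qPoch_inf (A * RtoC p / D)%CC p <> CC0 /\
  qPoch_inf (A * RtoC p / (B * C * D))%CC p <> CC0.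

Lemma wp_coef_S (p : R) (A B C D : CC) (n : nat) :
  0 < p < 1 -> wp_regular p A B C D ->
  wp_coef p A B C D (S n) = (wp_coef p A B C D n * wp_ratio p A B C D n)%CC.
Proof.
  intros Hp (HB & HC & HD & Pp & Pb & Pc & Pd & _).
  unfold wp_coef, wp_ratio. cbn [Cprod_upto]. rewrite !poch_S.
  pose proof (poch_neq0 _ _ n Hp Pp). pose proof (poch_factor_neq0 _ _ n Hp Pp).
  pose proof (poch_neq0 _ _ n Hp Pb). pose proof (poch_factor_neq0 _ _ n Hp Pb).
  pose proof (poch_neq0 _ _ n Hp Pc). pose proof (poch_factor_neq0 _ _ n Hp Pc).
  pose proof (poch_neq0 _ _ n Hp Pd). pose proof (poch_factor_neq0 _ _ n Hp Pd).
  set (b := (A * RtoC p / B)%CC) in *. set (c := (A * RtoC p / C)%CC) in *.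
  set (d := (A * RtoC p / D)%CC) in *.
  field. repeat split; assumption.
Qed.

Lemma wp_regular_shift (p : R) (A B C D : CC) (k : nat) :
  0 < p < 1 -> wp_regular p A B C D -> wp_regular p (A * RtoC (p ^ k)) B C D.
Proof.
  intros Hp (HB & HC & HD & Pp & Pb & Pc & Pd & Px).
  repeat split; try assumption.
  - replace (A * RtoC (p ^ k) * RtoC p / B)%CC with (A * RtoC p / B * RtoC (p ^ k))%CC
      by (field; assumption).
    apply qPoch_inf_shift_neq0; assumption.
  - replace (A * RtoC (p ^ k) * RtoC p / C)%CC with (A * RtoC p / C * RtoC (p ^ k))%CC
      by (field; assumption).
    apply qPoch_inf_shift_neq0; assumption.
  - replace (A * RtoC (p ^ k) * RtoC p / D)%CC with (A * RtoC p / D * RtoC (p ^ k))%CC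
      by (field; assumption).
    apply qPoch_inf_shift_neq0; assumption.
  - replace (A * RtoC (p ^ k) * RtoC p / (B * C * D))%CC
      with (A * RtoC p / (B * C * D) * RtoC (p ^ k))%CC by (field; repeat split; assumption).
    apply qPoch_inf_shift_neq0; assumption.
Qed.

(** * Telescoping relation between the parameters A and A p *)

Lemma poch_shift_div (p : R) (z : CC) (n : nat) :
  (CC1 - z)%CC <> CC0 ->
  poch p (z * RtoC p) n = (poch p z n * (CC1 - z * RtoC (p ^ n)) / (CC1 - z))%CC.
Proof. intros Hz. rewrite <- poch_shift. field. exact Hz. Qed.

Lemma Cprod_upto_geom (x y : CC) (p : R) (n : nat) :
  y = (x * RtoC p)%CC ->
  Cprod_upto (fun _ => y) n = (Cprod_upto (fun _ => x) n * RtoC (p ^ n))%CC.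
Proof.
  intros ->. induction n as [|n IH]; simpl.
  - change (RtoC 1) with CC1. ring.
  - rewrite IH, RtoC_mult. ring.
Qed.

(** Replacing A by A p multiplies A, A p / B, A p / C, A p / D and x by p, so each symbol changes by
    its two end factors and x^n gains p^n. The factor 1 - A stays on the left because [wp_regular]
    allows A = 1. *)
Lemma wp_coef_shift (p : R) (A B C D : CC) (n : nat) :
  0 < p < 1 -> wp_regular p A B C D ->
  ((CC1 - A) * wp_coef p (A * RtoC p) B C D n)%CC =
  (wp_coef p A B C D n * (CC1 - A * RtoC (p ^ n)) * RtoC (p ^ n)
   * ((CC1 - A * RtoC p / B) * (CC1 - A * RtoC p / C) * (CC1 - A * RtoC p / D))
   / ((CC1 - A * RtoC p / B * RtoC (p ^ n)) * (CC1 - A * RtoC p / C * RtoC (p ^ n))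
      * (CC1 - A * RtoC p / D * RtoC (p ^ n))))%CC.
Proof.
  intros Hp (HB & HC & HD & Pp & Pb & Pc & Pd & _).
  unfold wp_coef.
  rewrite (Cprod_upto_geom (A * RtoC p / (B * C * D)) (A * RtoC p * RtoC p / (B * C * D)) p)
    by (field; repeat split; assumption).
  replace (A * RtoC p * RtoC p / B)%CC with (A * RtoC p / B * RtoC p)%CC by (field; assumption).
  replace (A * RtoC p * RtoC p / C)%CC with (A * RtoC p / C * RtoC p)%CC by (field; assumption).
  replace (A * RtoC p * RtoC p / D)%CC with (A * RtoC p / D * RtoC p)%CC by (field; assumption).
  pose proof (poch_neq0 _ _ n Hp Pp).
  pose proof (poch_neq0 _ _ n Hp Pb). pose proof (poch_factor_neq0 _ _ n Hp Pb).
  pose proof (poch_neq0 _ _ n Hp Pc). pose proof (poch_factor_neq0 _ _ n Hp Pc).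
  pose proof (poch_neq0 _ _ n Hp Pd). pose proof (poch_factor_neq0 _ _ n Hp Pd).
  assert (N1 : forall z, qPoch_inf z p <> CC0 -> (CC1 - z)%CC <> CC0).
  { intros z Hz. rewrite (qPoch_inf_step p z Hp) in Hz. apply (CC_mul_neq0 _ _ Hz). }
  pose proof (N1 _ Pb). pose proof (N1 _ Pc). pose proof (N1 _ Pd).
  set (b := (A * RtoC p / B)%CC) in *. set (c := (A * RtoC p / C)%CC) in *.
  set (d := (A * RtoC p / D)%CC) in *. set (x := (A * RtoC p / (B * C * D))%CC).
  rewrite !(poch_shift_div p b), !(poch_shift_div p c), !(poch_shift_div p d) by assumption.
  (* Keeping 1 - A next to the symbol at A p lets [poch_shift] replace the pair without dividing by
     1 - A. *)
  transitivity ((CC1 - A) * poch p (A * RtoC p) n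
    * (poch p B n * poch p C n * poch p D n
    / (poch p (RtoC p) n * (poch p b n * (CC1 - b * RtoC (p ^ n)) / (CC1 - b)) *
     (poch p c n * (CC1 - c * RtoC (p ^ n)) / (CC1 - c)) *
     (poch p d n * (CC1 - d * RtoC (p ^ n)) / (CC1 - d)))) *
     (Cprod_upto (fun _ : nat => x) n * RtoC (p ^ n)))%CC.
  - field; repeat split; assumption.
  - rewrite poch_shift. field; repeat split; assumption.
Qed.

(* With y = p, N = p ^ n and h the n-th coefficient: the certificate (1 - N) (1 - A x N)
   telescopes the summand for A against the one for A p. *)
Lemma wp_telescope_identity (A B C D y N h : CC) :
  B <> CC0 -> C <> CC0 -> D <> CC0 ->
  (CC1 - y * N)%CC <> CC0 ->
  (CC1 - A * y / B * N)%CC <> CC0 -> (CC1 - A * y / C * N)%CC <> CC0 ->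
  (CC1 - A * y / D * N)%CC <> CC0 ->
  let x := (A * y / (B * C * D))%CC in
  ((CC1 - x) * ((CC1 - A * N * N) * h)
   - (CC1 - A * y / (B * C)) * (CC1 - A * y / (B * D)) * (CC1 - A * y / (C * D))
     * ((CC1 - A * y * N * N)
        * (h * (CC1 - A * N) * N
           / ((CC1 - A * y / B * N) * (CC1 - A * y / C * N) * (CC1 - A * y / D * N))))
   = (CC1 - N) * (CC1 - A * x * N) * h
     - (CC1 - y * N) * (CC1 - A * x * (y * N))
       * (h * ((CC1 - A * N) * (CC1 - B * N) * (CC1 - C * N) * (CC1 - D * N)
          / ((CC1 - y * N) * (CC1 - A * y / B * N)
             * (CC1 - A * y / C * N) * (CC1 - A * y / D * N)) * x)))%CC.
Proof.
  intros HB HC HD Hy Hb Hc Hd x. subst x.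
  (* [field] clears the inner quotients and asks for denominators in the form E - A y N. *)
  assert (G : forall E, E <> CC0 -> (CC1 - A * y / E * N)%CC <> CC0 -> (E - A * y * N)%CC <> CC0).
  { intros E HE H H0. apply H. replace (CC1 - A * y / E * N)%CC with ((E - A * y * N) / E)%CC by (field; exact HE).
    rewrite H0. field. exact HE. }
  field. repeat split; try assumption; apply G; assumption.
Qed.

(** Summation of the telescoping identity over n < N. The lower boundary term vanishes because of
    the factor 1 - p^0, so only the upper one remains. *)
Lemma wp_partial_sum_step (p : R) (A B C D : CC) (N : nat) :
  0 < p < 1 -> wp_regular p A B C D ->
  let x := (A * RtoC p / (B * C * D))%CC in
  let pb := ((CC1 - A * RtoC p / B) * (CC1 - A * RtoC p / C) * (CC1 - A * RtoC p / D))%CC in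
  ((CC1 - x) * pb * Csum_upto (wp_term p A B C D) N
   - (CC1 - A) * ((CC1 - A * RtoC p / (B * C)) * (CC1 - A * RtoC p / (B * D))
       * (CC1 - A * RtoC p / (C * D))) * Csum_upto (wp_term p (A * RtoC p) B C D) N
   = - (pb * ((CC1 - RtoC (p ^ N)) * (CC1 - A * x * RtoC (p ^ N)) * wp_coef p A B C D N)))%CC.
Proof.
  intros Hp Hreg x pb.
  pose proof Hreg as (HB & HC & HD & Pp & Pb & Pc & Pd & _).
  induction N as [|n IH].
  - simpl. change (RtoC 1) with CC1. ring.
  - cbn [Csum_upto].
    pose proof (poch_factor_neq0 _ _ n Hp Pp) as Np. pose proof (poch_factor_neq0 _ _ n Hp Pb) as Nb.
    pose proof (poch_factor_neq0 _ _ n Hp Pc) as Nc. pose proof (poch_factor_neq0 _ _ n Hp Pd) as Nd.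
    pose proof (wp_telescope_identity A B C D (RtoC p) (RtoC (p ^ n)) (wp_coef p A B C D n)
      HB HC HD Np Nb Nc Nd) as T. cbv zeta in T. fold x in T.
    pose proof (wp_coef_shift p A B C D n Hp Hreg) as Sh. fold pb in Sh.
    rewrite wp_coef_S by assumption. unfold wp_ratio. fold x.
    replace (RtoC (p ^ S n)) with (RtoC p * RtoC (p ^ n))%CC by (simpl pow; rewrite RtoC_mult; reflexivity).
    (* Only the two new summands are opened; the partial sums stay folded for the induction
       hypothesis. *)
    unfold wp_term at 2 4.
    set (r := (_ * (CC1 - D * RtoC (p ^ n)) / _ * x)%CC) in *.
    set (den := ((CC1 - A * RtoC p / B * RtoC (p ^ n)) * (CC1 - A * RtoC p / C * RtoC (p ^ n)) *
      (CC1 - A * RtoC p / D * RtoC (p ^ n)))%CC) in *.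
    assert (Hden : den <> CC0).
    { unfold den. repeat apply CC_neq0_mul; assumption. }
    set (h := wp_coef p A B C D n) in *. set (h' := wp_coef p (A * RtoC p) B C D n) in *.
    set (M := RtoC (p ^ n)) in *.
    set (m := ((CC1 - A * RtoC p / (B * C)) * (CC1 - A * RtoC p / (B * D))
       * (CC1 - A * RtoC p / (C * D)))%CC) in *.
    set (S1 := Csum_upto (wp_term p A B C D) n) in *.
    set (S2 := Csum_upto (wp_term p (A * RtoC p) B C D) n) in *.
    transitivity (((CC1 - x) * pb * S1 - (CC1 - A) * m * S2)
      + (pb * ((CC1 - x) * ((CC1 - A * M * M) * h))
      - m * (CC1 - A * RtoC p * M * M) * ((CC1 - A) * h')))%CC; [ring|].
    rewrite IH, Sh.
    transitivity (- (pb * ((CC1 - M) * (CC1 - A * x * M) * h)) +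
      pb * ((CC1 - x) * ((CC1 - A * M * M) * h) - m * ((CC1 - A * RtoC p * M * M) * (h * (CC1 - A * M) * M / den))))%CC;
      [field; exact Hden|].
    rewrite T. ring.
Qed.

(** * Vanishing of the boundary term and iteration of A to A p^k *)

Lemma Cnorm_prod_const (x : CC) (n : nat) :
  Cnorm (Cprod_upto (fun _ => x) n) = Cnorm x ^ n.
Proof.
  induction n as [|n IH]; simpl.
  - apply Cnorm_CC1.
  - rewrite Cnorm_mul, IH. ring.
Qed.

(** The quotient of Pochhammer symbols has a finite limit, since the limits in its denominator are
    nonzero, and x^n tends to 0. *)
Lemma wp_coef_cv0 (p : R) (A B C D : CC) :
  0 < p < 1 -> wp_regular p A B C D -> Cnorm (A * RtoC p / (B * C * D))%CC < 1 ->
  Cseq_cv (wp_coef p A B C D) CC0.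
Proof.
  intros Hp (HB & HC & HD & Pp & Pb & Pc & Pd & _) Hx.
  unfold wp_coef. set (x := (A * RtoC p / (B * C * D))%CC) in *.
  match goal with |- Cseq_cv ?u _ =>
    (* The limit l of the quotient is left to unification; its value is irrelevant after
       multiplication by 0. *)
    assert (H : exists l, Cseq_cv u (l * CC0)%CC) end.
  - eexists. apply Cseq_cv_mul.
    + apply Cseq_cv_div.
      2, 3: repeat apply Cseq_cv_mul; apply poch_cv, Hp.
      repeat apply CC_neq0_mul; assumption.
    + apply Cseq_cv_0_norm. eapply is_lim_seq_ext.
      { intros n. symmetry. apply Cnorm_prod_const. }
      apply is_lim_seq_geom. rewrite Rabs_pos_eq by apply Cnorm_ge0. exact Hx.
  - destruct H as [l H]. replace (l * CC0)%CC with CC0 in H by ring. exact H.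
Qed.

Definition wp_factor (p : R) (A B C D : CC) (k : nat) : CC :=
  (poch p A k * poch p (A * RtoC p / (B * C)) k
   * poch p (A * RtoC p / (B * D)) k * poch p (A * RtoC p / (C * D)) k
   / (poch p (A * RtoC p / B) k * poch p (A * RtoC p / C) k
      * poch p (A * RtoC p / D) k * poch p (A * RtoC p / (B * C * D)) k))%CC.

Lemma Cnorm_shrink (x : CC) (p : R) (k : nat) :
  0 < p < 1 -> Cnorm (x * RtoC (p ^ k)) <= Cnorm x.
Proof.
  intros Hp. rewrite Cnorm_mul, Cnorm_RtoC by (apply pow_le; lra).
  pose proof (Cnorm_ge0 x). pose proof (pow_incr p 1 k ltac:(lra)). rewrite pow1 in *. nra.
Qed.

(** Dividing the finite relation by its leading coefficient leaves a bounded multiple of [wp_coef].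
    Only the difference of partial sums is treated here; convergence of the series itself is
    obtained at the end. *)
Lemma wp_partial_sum_step_cv (p : R) (A B C D : CC) :
  0 < p < 1 -> wp_regular p A B C D -> Cnorm (A * RtoC p / (B * C * D))%CC < 1 ->
  Cseq_cv (fun N => Csum_upto (wp_term p A B C D) N
    - (CC1 - A) * ((CC1 - A * RtoC p / (B * C)) * (CC1 - A * RtoC p / (B * D))
       * (CC1 - A * RtoC p / (C * D)))
      / ((CC1 - A * RtoC p / B) * (CC1 - A * RtoC p / C) * (CC1 - A * RtoC p / D)
         * (CC1 - A * RtoC p / (B * C * D)))
      * Csum_upto (wp_term p (A * RtoC p) B C D) N)%CC CC0.
Proof.
  intros Hp Hreg Hx.
  pose proof Hreg as (HB & HC & HD & Pp & Pb & Pc & Pd & Px).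
  assert (N1 : forall z, qPoch_inf z p <> CC0 -> (CC1 - z)%CC <> CC0).
  { intros z Hz. rewrite (qPoch_inf_step p z Hp) in Hz. apply (CC_mul_neq0 _ _ Hz). }
  pose proof (N1 _ Pb). pose proof (N1 _ Pc). pose proof (N1 _ Pd). pose proof (N1 _ Px).
  pose proof (fun N => wp_partial_sum_step p A B C D N Hp Hreg) as T. cbv zeta in T.
  set (x := (A * RtoC p / (B * C * D))%CC) in *.
  set (b := (A * RtoC p / B)%CC) in *. set (c := (A * RtoC p / C)%CC) in *.
  set (d := (A * RtoC p / D)%CC) in *.
  set (m := ((CC1 - A * RtoC p / (B * C)) * (CC1 - A * RtoC p / (B * D))
       * (CC1 - A * RtoC p / (C * D)))%CC) in *.
  apply Cseq_cv_ext with (fun N => - (CC1 / (CC1 - x)) *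
    (((CC1 - RtoC (p ^ N)) * (CC1 - A * x * RtoC (p ^ N))) * wp_coef p A B C D N))%CC.
  - intros N. specialize (T N).
    transitivity ((- ((CC1 - b) * (CC1 - c) * (CC1 - d) * ((CC1 - RtoC (p ^ N)) * (CC1 - A * x * RtoC (p ^ N)) * wp_coef p A B C D N)))
       / ((CC1 - x) * ((CC1 - b) * (CC1 - c) * (CC1 - d))))%CC.
    + field; repeat split; assumption.
    + rewrite <- T. field; repeat split; assumption.
  - replace CC0 with (- (CC1 / (CC1 - x)) * (((CC1 - CC0) * (CC1 - A * x * CC0)) * CC0))%CC at 1 by ring.
    pose proof (RtoC_pow_cv0 p Hp) as Hpow.
    apply Cseq_cv_mul; [apply Cseq_cv_const|].
    apply Cseq_cv_mul; [|apply wp_coef_cv0; assumption].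
    apply Cseq_cv_mul; (apply Cseq_cv_sub; [apply Cseq_cv_const|]); [exact Hpow|].
    apply Cseq_cv_mul; [apply Cseq_cv_const|exact Hpow].
Qed.

(** The error for k + 1 is the error for k plus [wp_factor] at k times the one-step error at A p^k.
    The shifted argument x p^k still has norm below 1. *)
Lemma wp_partial_sum_shift_cv (p : R) (A B C D : CC) (k : nat) :
  0 < p < 1 -> wp_regular p A B C D -> Cnorm (A * RtoC p / (B * C * D))%CC < 1 ->
  Cseq_cv (fun N => Csum_upto (wp_term p A B C D) N
    - wp_factor p A B C D k * Csum_upto (wp_term p (A * RtoC (p ^ k)) B C D) N)%CC CC0.
Proof.
  intros Hp Hreg Hx. pose proof Hreg as (HB & HC & HD & Pp & Pb & Pc & Pd & Px).
  induction k as [|k IH].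
  - apply Cseq_cv_ext with (2 := Cseq_cv_const CC0). intros N.
    unfold wp_factor, poch; simpl. change (RtoC 1) with CC1.
    replace (A * CC1)%CC with A by ring. field. exact CC1_neq0.
  - pose proof (wp_partial_sum_step_cv p (A * RtoC (p ^ k)) B C D Hp
      (wp_regular_shift _ _ _ _ _ k Hp Hreg)) as St.
    assert (E : forall z, z <> CC0 -> (A * RtoC (p ^ k) * RtoC p / z)%CC = (A * RtoC p / z * RtoC (p ^ k))%CC).
    { intros z Hz. field. exact Hz. }
    rewrite !E in St by (repeat apply CC_neq0_mul; assumption).
    specialize (St (Rle_lt_trans _ _ _ (Cnorm_shrink _ p k Hp) Hx)).
    pose proof (Cseq_cv_add _ _ _ _ IH
      (Cseq_cv_mul _ _ _ _ (Cseq_cv_const (wp_factor p A B C D k)) St)) as H.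
    replace (CC0 + wp_factor p A B C D k * CC0)%CC with CC0 in H by ring.
    apply Cseq_cv_ext with (2 := H). intros N.
    replace (A * RtoC (p ^ S k))%CC with (A * RtoC (p ^ k) * RtoC p)%CC
      by (simpl pow; rewrite RtoC_mult; ring).
    unfold wp_factor. rewrite !poch_S.
    pose proof (poch_neq0 _ _ k Hp Pb). pose proof (poch_factor_neq0 _ _ k Hp Pb).
    pose proof (poch_neq0 _ _ k Hp Pc). pose proof (poch_factor_neq0 _ _ k Hp Pc).
    pose proof (poch_neq0 _ _ k Hp Pd). pose proof (poch_factor_neq0 _ _ k Hp Pd).
    pose proof (poch_neq0 _ _ k Hp Px). pose proof (poch_factor_neq0 _ _ k Hp Px).
    set (x := (A * RtoC p / (B * C * D))%CC) in *.
    set (b := (A * RtoC p / B)%CC) in *. set (c := (A * RtoC p / C)%CC) in *.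
    set (d := (A * RtoC p / D)%CC) in *.
    set (bc := (A * RtoC p / (B * C))%CC) in *. set (bd := (A * RtoC p / (B * D))%CC) in *.
    set (cd := (A * RtoC p / (C * D))%CC) in *.
    field. repeat split; assumption.
Qed.

(** * Estimates uniform in the number of summands *)

Lemma Cnorm_one_sub_le (z : CC) (r : R) : 0 <= r <= 1 -> Cnorm (CC1 - z * RtoC r) <= 1 + Cnorm z.
Proof.
  intros Hr. apply Rle_trans with (1 := Cnorm_sub _ _).
  rewrite Cnorm_CC1, Cnorm_mul, Cnorm_RtoC by lra. pose proof (Cnorm_ge0 z). nra.
Qed.

Lemma Cnorm_one_sub_ge (z : CC) (r : R) : 0 <= r <= 1 -> 1 - Cnorm z <= Cnorm (CC1 - z * RtoC r).
Proof.
  intros Hr. apply Rle_trans with (2 := Cnorm_sub_ge _ _).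
  rewrite Cnorm_CC1, Cnorm_mul, Cnorm_RtoC by lra. pose proof (Cnorm_ge0 z). nra.
Qed.

Lemma pow_unit_interval (p : R) (n : nat) : 0 < p < 1 -> 0 <= p ^ n <= 1.
Proof.
  intros Hp. split; [apply pow_le; lra|]. pose proof (pow_incr p 1 n ltac:(lra)) as H.
  rewrite pow1 in H. exact H.
Qed.

Lemma eventually_mul_pow_le (p M e : R) : 0 < p < 1 -> 0 < e ->
  exists K : nat, forall k, (K <= k)%nat -> M * p ^ k <= e.
Proof.
  intros Hp He.
  assert (H : is_lim_seq (fun k => M * p ^ k) (M * 0)).
  { apply is_lim_seq_mult'; [apply is_lim_seq_const|]. apply is_lim_seq_geom. rewrite Rabs_pos_eq; lra. }
  rewrite Rmult_0_r in H. apply is_lim_seq_Reals in H. destruct (H e He) as [K HK].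
  exists K. intros k Hk. specialize (HK k Hk). unfold Rdist in HK. rewrite Rminus_0_r in HK.
  pose proof (Rle_abs (M * p ^ k)). lra.
Qed.

(** The factor p^k comes from the argument x p^k. The remaining quotient is at most U / L for all n:
    the numerator factors are bounded by 1 plus a norm, 1 - p^(n+1) is at least 1 - p, and for large
    k the other three denominator factors have norm at least 1/2. *)
Lemma wp_ratio_bound (p : R) (A B C D : CC) :
  0 < p < 1 -> wp_regular p A B C D ->
  exists (M : R) (K : nat), 0 <= M /\ forall k n, (K <= k)%nat ->
    Cnorm (wp_ratio p (A * RtoC (p ^ k)) B C D n) <= M * p ^ k.
Proof.
  intros Hp (HB & HC & HD & _).
  set (x := (A * RtoC p / (B * C * D))%CC).
  set (b := (A * RtoC p / B)%CC). set (c := (A * RtoC p / C)%CC). set (d := (A * RtoC p / D)%CC).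
  destruct (eventually_mul_pow_le p (Cnorm b) (1/2) Hp ltac:(lra)) as [K1 H1].
  destruct (eventually_mul_pow_le p (Cnorm c) (1/2) Hp ltac:(lra)) as [K2 H2].
  destruct (eventually_mul_pow_le p (Cnorm d) (1/2) Hp ltac:(lra)) as [K3 H3].
  set (U := (1 + Cnorm A) * (1 + Cnorm B) * (1 + Cnorm C) * (1 + Cnorm D)).
  set (L := (1 - p) * (1/2) * (1/2) * (1/2)).
  assert (HL : 0 < L) by (unfold L; lra).
  pose proof (Cnorm_ge0 A). pose proof (Cnorm_ge0 B). pose proof (Cnorm_ge0 C).
  pose proof (Cnorm_ge0 D). pose proof (Cnorm_ge0 x) as Hx0.
  assert (HU : 0 <= U) by (unfold U; repeat apply Rmult_le_pos; lra).
  exists (U / L * Cnorm x), (Nat.max K1 (Nat.max K2 K3)). split.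
  { apply Rmult_le_pos; [apply Rcomplements.Rdiv_le_0_compat; lra|assumption]. }
  intros k n Hk. specialize (H1 k ltac:(lia)). specialize (H2 k ltac:(lia)). specialize (H3 k ltac:(lia)).
  unfold wp_ratio.
  assert (E : forall z, z <> CC0 -> (A * RtoC (p ^ k) * RtoC p / z)%CC = (A * RtoC p / z * RtoC (p ^ k))%CC).
  { intros z Hz. field. exact Hz. }
  rewrite !E by (repeat apply CC_neq0_mul; assumption).
  fold x b c d.
  pose proof (pow_unit_interval p n Hp) as Hn. pose proof (pow_unit_interval p k Hp) as Hk1.
  assert (Hge : forall z, Cnorm z * p ^ k <= 1/2 -> 1/2 <= Cnorm (CC1 - z * RtoC (p ^ k) * RtoC (p ^ n))).
  { intros z Hz. pose proof (Cnorm_one_sub_ge (z * RtoC (p ^ k)) (p ^ n) Hn) as G.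
    rewrite Cnorm_mul, Cnorm_RtoC in G by lra. lra. }
  set (den := (_ * (CC1 - d * RtoC (p ^ k) * RtoC (p ^ n)))%CC).
  assert (Hden : L <= Cnorm den).
  { unfold den, L. rewrite !Cnorm_mul.
    assert (1 - p <= Cnorm (CC1 - RtoC p * RtoC (p ^ n))).
    { pose proof (Cnorm_one_sub_ge (RtoC p) (p ^ n) Hn) as G. rewrite Cnorm_RtoC in G by lra. exact G. }
    pose proof (Hge b H1). pose proof (Hge c H2). pose proof (Hge d H3).
    repeat (apply Rmult_le_compat; [lra|lra| |assumption]). assumption. }
  assert (Hden0 : den <> CC0).
  { intros Z. rewrite Z in Hden. change CC0 with (RtoC 0) in Hden. rewrite Cnorm_RtoC in Hden by lra. lra. }
  rewrite Cnorm_mul, Cnorm_div by exact Hden0.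
  rewrite (Cnorm_mul x), (Cnorm_RtoC (p ^ k)) by lra. rewrite <- Rmult_assoc.
  apply Rmult_le_compat_r; [lra|]. apply Rmult_le_compat_r; [exact Hx0|].
  unfold Rdiv. apply Rmult_le_compat.
  - apply Cnorm_ge0.
  - left. apply Rinv_0_lt_compat. lra.
  - rewrite !Cnorm_mul. unfold U.
    repeat (apply Rmult_le_compat; [repeat apply Rmult_le_pos; apply Cnorm_ge0|apply Cnorm_ge0| |apply Cnorm_one_sub_le; exact Hn]).
    apply Rle_trans with (1 := Cnorm_one_sub_le _ _ Hn). pose proof (Cnorm_shrink A p k Hp). lra.
  - apply Rinv_le_contravar; assumption.
Qed.

(** The first term is 1 - A p^k, and the others are dominated by a geometric series of ratio M p^k
    <= 1/2. The sum has [S N] terms because the empty one is 0, not near 1. *)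
Lemma wp_partial_sum_near1 (p : R) (A B C D : CC) :
  0 < p < 1 -> wp_regular p A B C D ->
  exists (M : R) (K : nat), forall k N, (K <= k)%nat ->
    Cnorm (Csum_upto (wp_term p (A * RtoC (p ^ k)) B C D) (S N) - CC1) <= M * p ^ k.
Proof.
  intros Hp Hreg.
  destruct (wp_ratio_bound p A B C D Hp Hreg) as (M & K1 & HM & HK1).
  destruct (eventually_mul_pow_le p M (1/2) Hp ltac:(lra)) as [K2 HK2].
  exists (Cnorm A + (1 + Cnorm A) * (2 * M)), (Nat.max K1 K2). intros k N Hk.
  specialize (HK2 k ltac:(lia)).
  pose proof (fun n => HK1 k n ltac:(lia)) as Hr. clear HK1.
  pose proof (wp_regular_shift _ _ _ _ _ k Hp Hreg) as Hreg'.
  pose proof (Cnorm_shrink A p k Hp) as HA.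
  pose proof (pow_unit_interval p k Hp) as Hpk.
  set (A' := (A * RtoC (p ^ k))%CC) in *. set (y := M * p ^ k) in *.
  assert (Hy : 0 <= y) by (unfold y; nra).
  assert (Hcoef : forall n, Cnorm (wp_coef p A' B C D n) <= y ^ n).
  { induction n as [|n IH].
    - unfold wp_coef, poch; simpl.
      replace (_ * CC1)%CC with CC1; [rewrite Cnorm_CC1; lra|].
      field. exact CC1_neq0.
    - rewrite wp_coef_S by assumption. rewrite Cnorm_mul. simpl pow. rewrite (Rmult_comm y).
      apply Rmult_le_compat; try apply Cnorm_ge0; [exact IH|apply Hr]. }
  assert (Hterm : forall n, Cnorm (wp_term p A' B C D n) <= (1 + Cnorm A) * y ^ n).
  { intros n. unfold wp_term. rewrite Cnorm_mul.
    apply Rmult_le_compat; try apply Cnorm_ge0; [|apply Hcoef].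
    apply Rle_trans with (1 := Cnorm_one_sub_le _ _ (pow_unit_interval p n Hp)).
    pose proof (Cnorm_shrink A' p n Hp). lra. }
  assert (HA' : Cnorm A' = Cnorm A * p ^ k).
  { unfold A'. rewrite Cnorm_mul, Cnorm_RtoC by lra. reflexivity. }
  (* The correction - 2 y^(N+1) makes the bound inductive: the next term costs y^(N+1), and 2
     y^(N+2) <= y^(N+1) since y <= 1/2. *)
  assert (Hsum : Cnorm (Csum_upto (wp_term p A' B C D) (S N) - CC1)
    <= Cnorm A' + (1 + Cnorm A) * (2 * y - 2 * y ^ S N)).
  { induction N as [|N IH].
    - cbn [Csum_upto]. unfold wp_term, wp_coef, poch; cbn [Cprod_upto pow].
      replace (CC0 + _ - CC1)%CC with (- A')%CC.
      + rewrite Cnorm_opp. lra.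
      + change (RtoC 1) with CC1. field. exact CC1_neq0.
    - remember (S N) as N' eqn:EN. cbn [Csum_upto].
      replace (Csum_upto (wp_term p A' B C D) N' + wp_term p A' B C D N' - CC1)%CC
        with (Csum_upto (wp_term p A' B C D) N' - CC1 + wp_term p A' B C D N')%CC by ring.
      apply Rle_trans with (1 := Cnorm_add _ _).
      apply Rle_trans with (1 := Rplus_le_compat _ _ _ _ IH (Hterm N')).
      simpl pow. pose proof (pow_le y N' Hy). pose proof (Cnorm_ge0 A).
      assert (0 <= (1 + Cnorm A) * (y ^ N' - 2 * (y * y ^ N'))) by (apply Rmult_le_pos; nra).
      nra. }
  apply Rle_trans with (1 := Hsum).
  pose proof (pow_le y (S N) Hy). pose proof (Cnorm_ge0 A). rewrite HA'.
  pose proof (Rmult_le_pos (1 + Cnorm A) (y ^ S N) ltac:(lra) ltac:(assumption)).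
  unfold y in *. lra.
Qed.

(** * Passage to the limit in the 6phi5 sum *)

Lemma wp_factor_cv (p : R) (A B C D : CC) :
  0 < p < 1 -> wp_regular p A B C D ->
  Cseq_cv (wp_factor p A B C D)
    (qPoch_inf A p * qPoch_inf (A * RtoC p / (B * C)) p
     * qPoch_inf (A * RtoC p / (B * D)) p * qPoch_inf (A * RtoC p / (C * D)) p
     / (qPoch_inf (A * RtoC p / B) p * qPoch_inf (A * RtoC p / C) p
        * qPoch_inf (A * RtoC p / D) p * qPoch_inf (A * RtoC p / (B * C * D)) p))%CC.
Proof.
  intros Hp (HB & HC & HD & Pp & Pb & Pc & Pd & Px). unfold wp_factor.
  apply Cseq_cv_div.
  - repeat apply CC_neq0_mul; assumption.
  - repeat apply Cseq_cv_mul; apply poch_cv, Hp.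
  - repeat apply Cseq_cv_mul; apply poch_cv, Hp.
Qed.

(** An argument with three errors of size eps / 3. First k is fixed, so that the finite product F is
    close to V and the shifted sum is close to 1 for every number of terms; only then is the number
    of terms taken large, depending on k. *)
Lemma nonterminating_6phi5 (p : R) (A B C D : CC) :
  0 < p < 1 -> wp_regular p A B C D -> Cnorm (A * RtoC p / (B * C * D))%CC < 1 ->
  Cseq_cv (Csum_upto (wp_term p A B C D))
    (qPoch_inf A p * qPoch_inf (A * RtoC p / (B * C)) p
     * qPoch_inf (A * RtoC p / (B * D)) p * qPoch_inf (A * RtoC p / (C * D)) p
     / (qPoch_inf (A * RtoC p / B) p * qPoch_inf (A * RtoC p / C) p
        * qPoch_inf (A * RtoC p / D) p * qPoch_inf (A * RtoC p / (B * C * D)) p))%CC.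
Proof.
  intros Hp Hreg Hx eps He.
  pose proof (wp_factor_cv p A B C D Hp Hreg) as HR.
  match type of HR with Cseq_cv _ ?l => set (V := l) in * end.
  destruct (wp_partial_sum_near1 p A B C D Hp Hreg) as (M & K1 & HM).
  (* T bounds the norm of F once F is within eps / 3 of V, hence the tolerance eps / 3 / T for the
     shifted sum. *)
  set (T := Cnorm V + eps / 3).
  assert (HT : 0 < T) by (unfold T; pose proof (Cnorm_ge0 V); lra).
  destruct (HR (eps / 3) ltac:(lra)) as [K2 HK2].
  destruct (eventually_mul_pow_le p M (eps / 3 / T) Hp) as [K3 HK3].
  { apply Rdiv_lt_0_compat; lra. }
  set (k := Nat.max K1 (Nat.max K2 K3)).
  specialize (HK2 k ltac:(lia)). specialize (HK3 k ltac:(lia)).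
  destruct (wp_partial_sum_shift_cv p A B C D k Hp Hreg Hx (eps / 3) ltac:(lra)) as [N0 HN0].
  exists (S N0). intros n Hn. specialize (HN0 n ltac:(lia)).
  destruct n as [|n]; [lia|]. specialize (HM k n ltac:(lia)).
  set (S1 := Csum_upto (wp_term p A B C D) (S n)) in *.
  set (S2 := Csum_upto (wp_term p (A * RtoC (p ^ k)) B C D) (S n)) in *.
  set (F := wp_factor p A B C D k) in *.
  replace (S1 - V)%CC with ((S1 - F * S2 - CC0) + (F * (S2 - CC1) + (F - V)))%CC by ring.
  apply Rle_lt_trans with (1 := Cnorm_add _ _).
  pose proof (Cnorm_add (F * (S2 - CC1)) (F - V)) as H1. rewrite Cnorm_mul in H1.
  assert (HF : Cnorm F <= T).
  { pose proof (Cnorm_sub_ge F V). unfold T. lra. }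
  assert (H2 : Cnorm F * Cnorm (S2 - CC1) <= T * (eps / 3 / T)).
  { apply Rmult_le_compat; try apply Cnorm_ge0; lra. }
  replace (T * (eps / 3 / T)) with (eps / 3) in H2 by (field; lra).
  lra.
Qed.

(** * q-powers and q-gamma quotients *)

Lemma Cexp_add (z w : CC) : Cexp (z + w) = (Cexp z * Cexp w)%CC.
Proof.
  apply CC_ext; simpl; rewrite exp_plus, ?cos_plus, ?sin_plus; ring.
Qed.

Lemma Cexp_RtoC (x : R) : Cexp (RtoC x) = RtoC (exp x).
Proof. apply CC_ext; simpl; [rewrite cos_0|rewrite sin_0]; ring. Qed.

Lemma qpow_add (q : R) (x y : CC) : qpow q (x + y) = (qpow q x * qpow q y)%CC.
Proof. unfold qpow. rewrite <- Cexp_add. f_equal. ring. Qed.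

Lemma qpow_neq0 (q : R) (x : CC) : qpow q x <> CC0.
Proof.
  intros H.
  assert (E : (qpow q x * qpow q (- x))%CC = CC1).
  { rewrite <- qpow_add. unfold qpow. replace (_ * _)%CC with (RtoC 0) by (change (RtoC 0) with CC0; ring).
    rewrite Cexp_RtoC, exp_0. reflexivity. }
  rewrite H in E. apply (f_equal Cre) in E. simpl in E. lra.
Qed.

Lemma qpow_quot (q : R) (x y z : CC) : (x + y)%CC = z -> qpow q x = (qpow q z / qpow q y)%CC.
Proof. intros <-. rewrite qpow_add. field. apply qpow_neq0. Qed.

Lemma qpow_opp (q : R) (x : CC) : qpow q (- x) = (CC1 / qpow q x)%CC.
Proof.
  replace CC1 with (qpow q (RtoC 0)).
  - apply qpow_quot. change (RtoC 0) with CC0. ring.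
  - unfold qpow. rewrite <- RtoC_mult, Rmult_0_l, Cexp_RtoC, exp_0. reflexivity.
Qed.

Lemma qpow_INR (q : R) (n : nat) : 0 < q -> qpow q (RtoC (INR n)) = RtoC (q ^ n).
Proof.
  intros Hq. unfold qpow. rewrite <- RtoC_mult, Cexp_RtoC. f_equal.
  change (Rpower q (INR n) = q ^ n). apply Rpower_pow, Hq.
Qed.

Lemma qpow_1 (q : R) : 0 < q -> qpow q (RtoC 1) = RtoC q.
Proof. intros Hq. change 1 with (INR 1). rewrite qpow_INR by exact Hq. f_equal. simpl. ring. Qed.

Lemma qpow_2 (q : R) : 0 < q -> qpow q (RtoC 2) = RtoC (q ^ 2).
Proof. intros Hq. change 2 with (INR 2). apply qpow_INR, Hq. Qed.

Lemma qpow_mul_INR (q : R) (x : CC) (n : nat) :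
  qpow q (x * RtoC (INR n)) = Cprod_upto (fun _ => qpow q x) n.
Proof.
  induction n as [|n IH].
  - simpl. unfold qpow. replace (_ * _)%CC with (RtoC 0) by (change (RtoC 0) with CC0; ring).
    rewrite Cexp_RtoC, exp_0. reflexivity.
  - cbn [Cprod_upto]. rewrite <- IH, S_INR, RtoC_plus, <- qpow_add. f_equal.
    change (RtoC 1) with CC1. ring.
Qed.

Lemma Cnorm_qpow (q : R) (x : CC) : Cnorm (qpow q x) = exp (Cre x * ln q).
Proof.
  unfold Cnorm, qpow, Cexp; simpl.
  rewrite <- (sqrt_square (exp (Cre x * ln q))) by (left; apply exp_pos).
  f_equal. rewrite Rmult_0_r, Rminus_0_r.
  set (e := exp _). set (t := Cre x * 0 + Cim x * ln q).
  transitivity (e * e * (Rsqr (sin t) + Rsqr (cos t))); [unfold Rsqr; ring|].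
  rewrite sin2_cos2. ring.
Qed.

Lemma qfact2_poch (q : R) (n : nat) : 0 < q < 1 ->
  qfact2 q n = (poch (q ^ 2) (RtoC (q ^ 2)) n / RtoC ((1 - q ^ 2) ^ n))%CC.
Proof.
  intros Hq. assert (H1 : RtoC (1 - q ^ 2) <> CC0) by (apply RtoC_neq0; nra).
  assert (Hn : forall m, RtoC ((1 - q ^ 2) ^ m) <> CC0) by (intros m; apply RtoC_neq0, pow_nonzero; nra).
  induction n as [|n IH].
  - unfold qfact2, poch; simpl. change (RtoC 1) with CC1. field.
    exact CC1_neq0.
  - rewrite poch_S. unfold qfact2 in *. cbn [Cprod_upto]. rewrite IH. unfold qnum2.
    replace (qpow q (RtoC 2 * RtoC (INR (S n)))) with (RtoC (q ^ 2) * RtoC ((q ^ 2) ^ n))%CC.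
    + rewrite <- (tech_pow_Rmult (1 - q ^ 2) n), RtoC_mult.
      specialize (Hn n). field. split; assumption.
    + change (RtoC 2) with (RtoC (INR 2)). rewrite <- !RtoC_mult, <- mult_INR, qpow_INR by lra.
      rewrite pow_mult. reflexivity.
Qed.

(** In the gamma quotient (q^2;q^2)_oo cancels and the powers of 1 - q^2 combine to (1 - q^2)^(-y).
    That complex power is written with [qpow] at base 1 - q^2. *)
Lemma qshift_eq (q : R) (x y : CC) :
  0 < q < 1 -> qPoch_inf (RtoC (q ^ 2)) (q ^ 2) <> CC0 ->
  qGamma2_defined q x -> qGamma2_defined q (x + y) ->
  qshift q x y = (qPoch_inf (qpow q (RtoC 2 * x)) (q ^ 2)
    / (qPoch_inf (qpow q (RtoC 2 * (x + y))) (q ^ 2) * qpow (1 - q ^ 2) y))%CC.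
Proof.
  intros Hq Hp Hx Hxy. unfold qshift, qGamma2. unfold qGamma2_defined in *.
  fold (qpow (1 - q ^ 2) (CC1 - x)) (qpow (1 - q ^ 2) (CC1 - (x + y))).
  rewrite (qpow_quot _ (CC1 - (x + y)) y (CC1 - x)) by ring.
  pose proof (qpow_neq0 (1 - q ^ 2) y). pose proof (qpow_neq0 (1 - q ^ 2) (CC1 - x)).
  set (P := qPoch_inf (RtoC (q ^ 2)) (q ^ 2)) in *.
  field. repeat split; assumption.
Qed.

(** Isolates the dependence on n as a finite symbol and a power (1 - q^2)^n, by splitting (w;p)_oo
    after n factors. The separate [z] accommodates shifts written as n - b. *)
Lemma qshift_add_INR (q : R) (x y z : CC) (n : nat) :
  0 < q < 1 -> qPoch_inf (RtoC (q ^ 2)) (q ^ 2) <> CC0 ->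
  qGamma2_defined q x -> qGamma2_defined q (x + y) -> z = (y + RtoC (INR n))%CC ->
  qshift q x z = (qPoch_inf (qpow q (RtoC 2 * x)) (q ^ 2)
    * poch (q ^ 2) (qpow q (RtoC 2 * (x + y))) n
    / (qPoch_inf (qpow q (RtoC 2 * (x + y))) (q ^ 2) * qpow (1 - q ^ 2) y
       * RtoC ((1 - q ^ 2) ^ n)))%CC.
Proof.
  intros Hq Hp Hx Hxy ->.
  assert (Hp2 : 0 < q ^ 2 < 1) by (simpl; nra).
  assert (E : qpow q (RtoC 2 * (x + (y + RtoC (INR n))))
    = (qpow q (RtoC 2 * (x + y)) * RtoC ((q ^ 2) ^ n))%CC).
  { rewrite <- pow_mult, <- qpow_INR, mult_INR, RtoC_mult, <- qpow_add by lra.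
    f_equal. change (INR 2) with 2. ring. }
  assert (Hxn : qGamma2_defined q (x + (y + RtoC (INR n)))).
  { unfold qGamma2_defined in *. fold (RtoC 2). rewrite E. apply qPoch_inf_shift_neq0; assumption. }
  rewrite qshift_eq by assumption.
  rewrite E, qpow_add, (qpow_INR (1 - q ^ 2)) by lra.
  unfold qGamma2_defined in *. rewrite E in Hxn.
  pose proof (poch_neq0 _ _ n Hp2 Hxy). pose proof (qpow_neq0 (1 - q ^ 2) y).
  assert (RtoC ((1 - q ^ 2) ^ n) <> CC0) by (apply RtoC_neq0, pow_nonzero; lra).
  rewrite (qPoch_inf_split _ (qpow q (RtoC 2 * (x + y))) n Hp2).
  field. repeat split; assumption.
Qed.

(** * Specialisation of the 6phi5 sum to q-gamma quotients *)

Lemma Csum_upto_scal (c : CC) (u : nat -> CC) (n : nat) :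
  Csum_upto (fun k => c * u k)%CC n = (c * Csum_upto u n)%CC.
Proof. induction n as [|n IH]; simpl; [|rewrite IH]; ring. Qed.

Lemma Csum_upto_ext (u v : nat -> CC) (n : nat) :
  (forall k, u k = v k) -> Csum_upto u n = Csum_upto v n.
Proof. intros E. induction n as [|n IH]; simpl; congruence. Qed.

Ltac qpow_quotient hq :=
  symmetry; rewrite <- (qpow_2 _ hq), <- ?qpow_add;
  apply qpow_quot; apply CC_ext; simpl; lra.

Theorem theorem3p2 (q : R) (a b c d : CC)
  (hq0 : 0 < q) (hq1 : q < 1)
  (hre : Cre (Cadd (Cadd a b) (Cadd c d)) > 0)
  (hdefL : forall n : nat,
     qGamma2_defined q (Cadd (rc (1/2)) (Cadd a (nc n))) /\
     qGamma2_defined q (Cadd (rc (1/2)) (Csub (nc n) b)) /\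
     qGamma2_defined q (Cadd (rc (1/3)) (Csub (nc n) c)) /\
     qGamma2_defined q (Cadd (rc (2/3)) (Csub (nc n) d)) /\
     qGamma2_defined q (Cadd (rc 1) (Cadd (Cadd a b) (nc n))) /\
     qGamma2_defined q (Cadd (rc (7/6)) (Cadd (Cadd a c) (nc n))) /\
     qGamma2_defined q (Cadd (rc (5/6)) (Cadd (Cadd a d) (nc n))))
  (hdefC : qGamma2_defined q (rc (1/2)) /\ qGamma2_defined q (rc (1/3)) /\
     qGamma2_defined q (rc (2/3)) /\ qGamma2_defined q (rc 1) /\
     qGamma2_defined q (rc (7/6)) /\ qGamma2_defined q (rc (5/6)))
  (hdefR :
     qGamma2_defined q (Csub (rc (1/2)) b) /\
     qGamma2_defined q (Csub (rc (1/3)) c) /\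
     qGamma2_defined q (Csub (rc (2/3)) d) /\
     qGamma2_defined q (Cadd (rc 1) (Csub (Cadd (Cadd a b) (Cadd c d)) (rc 1))) /\
     qGamma2_defined q (Cadd (rc (1/3)) (Cadd (Cadd a b) d)) /\
     qGamma2_defined q (Cadd (rc (2/3)) (Cadd (Cadd a b) c)) /\
     qGamma2_defined q (Cadd (rc (1/2)) (Cadd (Cadd a c) d))) :
  Cseq_cv
    (Csum_upto (fun n : nat =>
       Cmul
         (Cdiv
            (Cmul (Cmul (Cmul (Cmul
               (Csub CC1 (qpow q (Cadd (Cadd (nc (4 * n)) (Cmul (rc 2) a)) (rc 1))))
               (qshift q (rc (1/2)) (Cadd a (nc n))))
               (qshift q (rc (1/2)) (Csub (nc n) b)))
               (qshift q (rc (1/3)) (Csub (nc n) c)))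
               (qshift q (rc (2/3)) (Csub (nc n) d)))
            (Cmul (Cmul (Cmul (Cmul
               (rc (1 - q ^ 2))
               (qfact2 q n))
               (qshift q (rc 1) (Cadd (Cadd a b) (nc n))))
               (qshift q (rc (7/6)) (Cadd (Cadd a c) (nc n))))
               (qshift q (rc (5/6)) (Cadd (Cadd a d) (nc n)))))
         (qpow q (Cmul (Cmul (rc 2) (Cadd (Cadd a b) (Cadd c d))) (nc n)))))
    (Cmul
       (Cdiv
          (Cmul (Cmul (Cmul
             (qshift q (rc (1/2)) (Copp b))
             (qshift q (rc (1/3)) (Copp c)))
             (qshift q (rc (2/3)) (Copp d)))
             (qshift q (rc 1) (Csub (Cadd (Cadd a b) (Cadd c d)) (rc 1))))
          (Cmul (Cmul
             (qshift q (rc (1/3)) (Cadd (Cadd a b) d))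
             (qshift q (rc (2/3)) (Cadd (Cadd a b) c)))
             (qshift q (rc (1/2)) (Cadd (Cadd a c) d))))
       (Cdiv
          (Cmul (Cmul (Cmul
             (qnum2 q (rc (1/6)))
             (qPoch_inf (qpow q (rc (4/3))) (q ^ 2)))
             (qPoch_inf (qpow q (rc (2/3))) (q ^ 2)))
             (qpow q (rc (1/4))))
          (Cmul (Cmul
             (qPoch_inf (qpow q (rc (1/3))) (q ^ 2))
             (qPoch_inf (qpow q (rc (5/3))) (q ^ 2)))
             (pi_q q)))).
Proof.
  assert (Hq : 0 < q < 1) by lra.
  assert (Hp : 0 < q ^ 2 < 1) by (simpl; nra).
  destruct hdefC as (dh & dt & du & d1 & d7 & d5).
  (* Nonvanishing at n = 0 passes to every n through [qPoch_inf_split]. *)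
  destruct (hdefL 0%nat) as (lA & _ & _ & _ & lb & lc & ld).
  destruct hdefR as (rB & rC & rD & rx & rbd & rbc & rcd).
  assert (n0 : forall z w, (z + (w + nc 0) = z + w)%CC).
  { intros z w. unfold nc; simpl. change (RtoC 0) with CC0. ring. }
  rewrite n0 in lA, lb, lc, ld. clear hdefL n0.
  change (rc (1/2) - b)%CC with (rc (1/2) + - b)%CC in rB.
  change (rc (1/3) - c)%CC with (rc (1/3) + - c)%CC in rC.
  change (rc (2/3) - d)%CC with (rc (2/3) + - d)%CC in rD.
  assert (X1 : qpow q (RtoC 2 * rc 1) = RtoC (q ^ 2)).
  { unfold rc. rewrite <- RtoC_mult, Rmult_1_r. apply qpow_2, hq0. }
  assert (PP : qPoch_inf (RtoC (q ^ 2)) (q ^ 2) <> CC0).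
  { unfold qGamma2_defined in d1. fold (RtoC 2) in d1. rewrite X1 in d1. exact d1. }
  assert (Hr : RtoC (1 - q ^ 2) <> CC0) by (apply RtoC_neq0; lra).
  rewrite (qshift_eq q (rc (1/2)) (- b)), (qshift_eq q (rc (1/3)) (- c)),
    (qshift_eq q (rc (2/3)) (- d)), (qshift_eq q (rc 1)), (qshift_eq q (rc (1/3)) (a + b + d)),
    (qshift_eq q (rc (2/3)) (a + b + c)), (qshift_eq q (rc (1/2)) (a + c + d)) by assumption.
  unfold qGamma2_defined in *.
  set (A := qpow q (RtoC 2 * (rc (1/2) + a))) in *.
  set (B := qpow q (RtoC 2 * (rc (1/2) + - b))) in *.
  set (C := qpow q (RtoC 2 * (rc (1/3) + - c))) in *.
  set (D := qpow q (RtoC 2 * (rc (2/3) + - d))) in *.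
  assert (eb : (A * RtoC (q ^ 2) / B)%CC = qpow q (RtoC 2 * (rc 1 + (a + b))))
    by (unfold A, B, C, D; qpow_quotient hq0).
  assert (ec : (A * RtoC (q ^ 2) / C)%CC = qpow q (RtoC 2 * (rc (7/6) + (a + c))))
    by (unfold A, B, C, D; qpow_quotient hq0).
  assert (ed : (A * RtoC (q ^ 2) / D)%CC = qpow q (RtoC 2 * (rc (5/6) + (a + d))))
    by (unfold A, B, C, D; qpow_quotient hq0).
  assert (ebc : (A * RtoC (q ^ 2) / (B * C))%CC = qpow q (RtoC 2 * (rc (2/3) + (a + b + c))))
    by (unfold A, B, C, D; qpow_quotient hq0).
  assert (ebd : (A * RtoC (q ^ 2) / (B * D))%CC = qpow q (RtoC 2 * (rc (1/3) + (a + b + d))))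
    by (unfold A, B, C, D; qpow_quotient hq0).
  assert (ecd : (A * RtoC (q ^ 2) / (C * D))%CC = qpow q (RtoC 2 * (rc (1/2) + (a + c + d))))
    by (unfold A, B, C, D; qpow_quotient hq0).
  assert (ex : (A * RtoC (q ^ 2) / (B * C * D))%CC = qpow q (RtoC 2 * (rc 1 + (a + b + (c + d) - rc 1))))
    by (unfold A, B, C, D; qpow_quotient hq0).
  (* The argument x is needed in two forms: [ex] matches the q-gamma value at 1 + (a+b+c+d-1), and
     this one the power in the summand. *)
  assert (ex' : (A * RtoC (q ^ 2) / (B * C * D))%CC = qpow q (rc 2 * (a + b + (c + d))))
    by (unfold A, B, C, D; qpow_quotient hq0).
  assert (Hln : ln q < 0) by (rewrite <- ln_1; apply ln_increasing; lra).
  (* The norm is exp(2 Re(a+b+c+d) ln q), with Re(a+b+c+d) > 0 and ln q < 0. *)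
  assert (Hx : Cnorm (A * RtoC (q ^ 2) / (B * C * D)) < 1).
  { rewrite ex', Cnorm_qpow, <- exp_0. apply exp_increasing.
    simpl in hre |- *. nra. }
  fold (RtoC 2) in lb.
  rewrite <- eb in lb. rewrite <- ec in lc. rewrite <- ed in ld. rewrite <- ebc in rbc |- *.
  rewrite <- ebd in rbd |- *. rewrite <- ecd in rcd |- *. rewrite <- ex in rx |- *.
  assert (Hreg : wp_regular (q ^ 2) A B C D).
  { repeat split; try assumption; apply qpow_neq0. }
  pose proof (nonterminating_6phi5 _ _ _ _ _ Hp Hreg Hx) as Hsum.
  rewrite !qpow_opp.
  replace (qpow (1 - q ^ 2) (a + b + (c + d) - rc 1)) with
    (qpow (1 - q ^ 2) a * qpow (1 - q ^ 2) b * qpow (1 - q ^ 2) c * qpow (1 - q ^ 2) d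
     / RtoC (1 - q ^ 2))%CC.
  2: { rewrite <- (qpow_1 (1 - q ^ 2)) by lra. rewrite <- !qpow_add. symmetry. apply qpow_quot.
       unfold rc. ring. }
  rewrite !qpow_add.
  pose proof (qpow_neq0 (1 - q ^ 2) a) as Ea. pose proof (qpow_neq0 (1 - q ^ 2) b) as Eb.
  pose proof (qpow_neq0 (1 - q ^ 2) c) as Ec. pose proof (qpow_neq0 (1 - q ^ 2) d) as Ed.
  (* K collects everything in the summand that is independent of n. Its powers of 1 - q^2 have total
     exponent 2(a+b+c+d) - 1. *)
  set (K := (qPoch_inf (qpow q (RtoC 2 * rc (1/2))) (q ^ 2) * qPoch_inf (qpow q (RtoC 2 * rc (1/2))) (q ^ 2)
    * qPoch_inf (qpow q (RtoC 2 * rc (1/3))) (q ^ 2) * qPoch_inf (qpow q (RtoC 2 * rc (2/3))) (q ^ 2)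
    * (qPoch_inf (A * RtoC (q ^ 2) / B) (q ^ 2) * qPoch_inf (A * RtoC (q ^ 2) / C) (q ^ 2)
       * qPoch_inf (A * RtoC (q ^ 2) / D) (q ^ 2))
    / (qPoch_inf A (q ^ 2) * qPoch_inf B (q ^ 2) * qPoch_inf C (q ^ 2) * qPoch_inf D (q ^ 2)
       * qPoch_inf (RtoC (q ^ 2)) (q ^ 2) * qPoch_inf (qpow q (RtoC 2 * rc (7/6))) (q ^ 2)
       * qPoch_inf (qpow q (RtoC 2 * rc (5/6))) (q ^ 2))
    * ((qpow (1 - q ^ 2) a * qpow (1 - q ^ 2) b * qpow (1 - q ^ 2) c * qpow (1 - q ^ 2) d)
       * (qpow (1 - q ^ 2) a * qpow (1 - q ^ 2) b * qpow (1 - q ^ 2) c * qpow (1 - q ^ 2) d)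
       / RtoC (1 - q ^ 2)))%CC).
  apply Cseq_cv_ext with (fun N => K * Csum_upto (wp_term (q ^ 2) A B C D) N)%CC.
  - intros N. rewrite <- Csum_upto_scal. apply Csum_upto_ext. intros n.
    rewrite (qshift_add_INR q (rc (1/2)) a (a + nc n) n) by (assumption || reflexivity).
    rewrite (qshift_add_INR q (rc (1/2)) (- b) (nc n - b) n) by (assumption || (unfold nc; ring)).
    rewrite (qshift_add_INR q (rc (1/3)) (- c) (nc n - c) n) by (assumption || (unfold nc; ring)).
    rewrite (qshift_add_INR q (rc (2/3)) (- d) (nc n - d) n) by (assumption || (unfold nc; ring)).
    fold A B C D.
    assert (Gb : qGamma2_defined q (rc 1 + (a + b))).
    { unfold qGamma2_defined. fold (RtoC 2). rewrite <- eb. exact lb. }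
    assert (Gc : qGamma2_defined q (rc (7/6) + (a + c))).
    { unfold qGamma2_defined. fold (RtoC 2). rewrite <- ec. exact lc. }
    assert (Gd : qGamma2_defined q (rc (5/6) + (a + d))).
    { unfold qGamma2_defined. fold (RtoC 2). rewrite <- ed. exact ld. }
    rewrite (qshift_add_INR q (rc 1) (a + b) (a + b + nc n) n) by (assumption || reflexivity).
    rewrite (qshift_add_INR q (rc (7/6)) (a + c) (a + c + nc n) n) by (assumption || reflexivity).
    rewrite (qshift_add_INR q (rc (5/6)) (a + d) (a + d + nc n) n) by (assumption || reflexivity).
    rewrite <- eb, <- ec, <- ed, X1, (qfact2_poch q n Hq).
    unfold nc at 2. rewrite qpow_mul_INR, <- ex'.
    replace (qpow q (nc (4 * n) + rc 2 * a + rc 1)) with (A * RtoC ((q ^ 2) ^ n) * RtoC ((q ^ 2) ^ n))%CC.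
    2: { unfold A. rewrite <- pow_mult, <- (qpow_INR q (2 * n)), <- !qpow_add by exact hq0. f_equal.
         unfold nc. rewrite !mult_INR. apply CC_ext; simpl; lra. }
    rewrite !qpow_opp, !qpow_add.
    unfold wp_term, wp_coef, K.
    pose proof (poch_neq0 _ _ n Hp PP). pose proof (poch_neq0 _ _ n Hp lb).
    pose proof (poch_neq0 _ _ n Hp lc). pose proof (poch_neq0 _ _ n Hp ld).
    (* The powers (1 - q^2)^n cancel: four from the numerator against three from the shifted
       factorials below and one from [n]!. *)
    assert (RtoC ((1 - q ^ 2) ^ n) <> CC0) by (apply RtoC_neq0, pow_nonzero; lra).
    change (rc (1 - q ^ 2)) with (RtoC (1 - q ^ 2)).
    clear eb ec ed ebc ebd ecd ex ex' K Hsum.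
    (* Turning the quotients into variables leaves [field] an identity in independent symbols. *)
    generalize dependent (A * RtoC (q ^ 2) / B)%CC. intros.
    generalize dependent (A * RtoC (q ^ 2) / C)%CC. intros.
    generalize dependent (A * RtoC (q ^ 2) / D)%CC. intros.
    generalize dependent (RtoC ((1 - q ^ 2) ^ n)). intros.
    field. repeat split; assumption.
  - assert (Xh : qpow q (RtoC 2 * rc (1/2)) = RtoC q).
    { rewrite <- (qpow_1 q hq0). f_equal. apply CC_ext; simpl; lra. }
    replace (qpow q (rc (4/3))) with (qpow q (RtoC 2 * rc (2/3)))
      by (f_equal; apply CC_ext; simpl; lra).
    replace (qpow q (rc (2/3))) with (qpow q (RtoC 2 * rc (1/3)))
      by (f_equal; apply CC_ext; simpl; lra).
    replace (qpow q (rc (5/3))) with (qpow q (RtoC 2 * rc (5/6)))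
      by (f_equal; apply CC_ext; simpl; lra).
    (* The factor 1 - q^(1/3) split off here cancels the numerator of [1/6], leaving
       (q^(7/3);q^2)_oo, which K contains. *)
    rewrite (qPoch_inf_step _ (qpow q (rc (1/3))) Hp).
    replace (qpow q (rc (1/3)) * RtoC (q ^ 2))%CC with (qpow q (RtoC 2 * rc (7/6)))
      by (rewrite <- (qpow_2 q hq0), <- qpow_add; f_equal; apply CC_ext; simpl; lra).
    unfold qnum2, pi_q. rewrite <- Xh.
    replace (qpow q (RtoC 2 * rc (1/6))) with (qpow q (rc (1/3)))
      by (f_equal; apply CC_ext; simpl; lra).
    (* Otherwise exp(ln q / 3) = 1, which contradicts ln q < 0. *)
    assert (N6 : (CC1 - qpow q (rc (1/3)))%CC <> CC0).
    { intros H. assert (E : qpow q (rc (1/3)) = CC1).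
      { transitivity (CC1 - (CC1 - qpow q (rc (1/3))))%CC; [ring|rewrite H; ring]. }
      apply (f_equal Cnorm) in E. rewrite Cnorm_qpow, Cnorm_CC1 in E.
      apply (f_equal ln) in E. rewrite ln_exp, ln_1 in E. simpl in E. lra. }
    match type of Hsum with Cseq_cv _ ?V => match goal with |- Cseq_cv _ ?W =>
      replace W with (K * V)%CC end end.
    { apply Cseq_cv_mul; [apply Cseq_cv_const|exact Hsum]. }
    pose proof (qpow_neq0 q (RtoC (1/4))) as N4.
    unfold K. rewrite X1. change (rc (1/4)) with (RtoC (1/4)).
    clear eb ec ed ebc ebd ecd ex ex' K Hsum.
    field. repeat split; assumption.
Qed.
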